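(* Let $D$ be a complete division ring of characteristic $0$. For any $n\ge0$ and any monomial $p_n(x)$ of power $n$ in one variable $x$ over $D$, i.e. $p_n(x)=a_0xa_1x\cdots xa_n$ with $a_0,\dots,a_n\in D$ (for $n=0$, $p_0(x)=a_0$), one has $$\partial^{n+1}p_n(x)(h_1;\dots;h_{n+1})=0$$ for all $x,h_1,\dots,h_{n+1}\in D$.
   Context: A complete division ring of characteristic $0$ is a division ring $D$ of characteristic $0$ with an absolute value $|\cdot|:D\to\mathbb R$ ($|a|\ge0$, $|a|=0$ iff $a=0$, $|ab|=|a||b|$, $|a+b|\le|a|+|b|$), complete for the metric $|a-b|$, such that the embedding of the rational field $\mathbb Q$ (usual topology) into $D$ is a homeomorphism onto its image; then $\mathbb R$ is a subfield of the center $Z(D)$. A map $f:D\to D$ is differentiable in the Gâteaux sense if at every $x$ one has $f(x+a)-f(x)=\partial f(x)(a)+o(a)$, where $a\mapsto\partial f(x)(a)$ is linear (additive and homogeneous over $Z(D)$) and $o$ is a continuous map with $|o(a)|/|a|\to0$ as $a\to0$; then $\partial f(x)(a)=\lim_{t\to0,\,t\in\mathbb R}t^{-1}(f(x+ta)-f(x))$. Higher derivatives: $\partial^0f(x)=f(x)$ and $\partial^nf(x)(h_1;\dots;h_n)=\partial\big(\partial^{n-1}f(x)(h_1;\dots;h_{n-1})\big)(h_n)$, the outer $\partial$ being taken with respect to $x$. *)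

(* Defs.v *)
From HB Require Import structures.
From mathcomp Require Import all_boot all_order all_algebra.
From mathcomp Require Import all_classical all_reals topology.

Set Implicit Arguments.
Unset Strict Implicit.
Unset Printing Implicit Defensive.

Import Order.TTheory GRing.Theory Num.Theory.
Import numFieldTopology.Exports.

Local Open Scope classical_set_scope.
Local Open Scope ring_scope.

Definition homeo_onto_image (S T : topologicalType) (f : S -> T) : Prop :=
  [/\ injective f, continuous f
    & forall U : set S, open U ->
        exists2 V : set T, open V & f @` U = range f `&` V].

(* [normedZmodType] would force |x *+ n| = |x| *+ n, which the absolute value
   of a division ring need not satisfy (the square root of the usual absolute
   value is allowed), hence a separate absolute value [dabs].
   The alias [rat^o] carries the topology of the distance |p - q|. *)
HB.mixin Record isCompleteDivRing (R : realType) D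
    & GRing.UnitRing D & Metric R D & Complete D := {
  dabs : D -> R ;
  dabs_ge0 : forall x, 0 <= dabs x ;
  dabs_eq0 : forall x, dabs x = 0 <-> x = 0 ;
  dabsM : forall x y, dabs (x * y) = dabs x * dabs y ;
  dabsD : forall x y, dabs (x + y) <= dabs x + dabs y ;
  mdist_dabs : forall x y : D, mdist x y = dabs (x - y) ;
  div_unit : forall x : D, x != 0 -> x \is a GRing.unit ;
  div_pchar0 : [pchar D] =i pred0 ;
  ratr_homeo : homeo_onto_image (ratr : rat^o -> D)
}.

#[short(type="completeDivRingType")]
HB.structure Definition CompleteDivRing (R : realType) :=
  {D of GRing.UnitRing D & Metric R D & Complete D & isCompleteDivRing R D}.

Section Gateaux.
Context {R : realType} {D : completeDivRingType R}.
Implicit Types (f L : D -> D) (x : D).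

Definition central (c : D) : Prop := forall y : D, GRing.comm c y.

Definition center_linear L : Prop :=
  {morph L : a b / a + b} /\
  forall c a : D, central c -> L (c * a) = c * L a.

Definition is_gateaux f x L : Prop :=
  center_linear L /\
  exists o : D -> D,
    [/\ forall a, f (x + a) - f x = L a + o a,
        continuous o
      & (dabs (o a) / dabs a) @[a --> (0 : D)^'] --> (0 : R)].

Definition gateaux_differentiable f : Prop :=
  forall x, exists L, is_gateaux f x L.

(* The value where [f] is not differentiable is junk. *)
Definition gateaux f x : D -> D :=
  xget (fun=> 0) [set L | is_gateaux f x L].

(* [h] lists the increments in order of differentiation: for h = h1; ...; hk,
   this is x |-> the k-th derivative at x applied to (h1; ...; hk). *)
Definition ngateaux f (h : seq D) : D -> D :=
  foldl (fun g hi x => gateaux g x hi) f h.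

Definition monomial n (a : 'I_n.+1 -> D) (x : D) : D :=
  a ord0 * \prod_(i < n) (x * a (lift ord0 i)).

End Gateaux.

(* Main.v *)
Require Import Defs.
From HB Require Import structures.
From mathcomp Require Import all_boot all_order all_algebra.
From mathcomp Require Import all_classical all_reals topology.

Set Implicit Arguments.
Unset Strict Implicit.
Unset Printing Implicit Defensive.

Import Order.TTheory GRing.Theory Num.Theory.
Import numFieldTopology.Exports.
Local Open Scope ring_scope.

(** The statement rests on two facts.

    A Gateaux derivative is unique ([is_gateaux_unique]).  The difference [M]
    of two candidates at a point is linear over the center and satisfies
    [|M a| = o(|a|)].  The center contains arbitrarily small nonzero elements,
    namely the images of small rationals ([small_central]); replacing [a] by
    [t a] with [t] small and central leaves [|M a| / |a|] unchanged, so this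
    ratio is 0.  Hence any derivative found by hand is the chosen one.

    Each differentiation of a product hits one factor only.  Call a function
    annihilated in [k] steps ([annihilated]) when it can be differentiated
    [k] times and the result is then 0.  Constants are annihilated in one
    step, the identity in two, and by the Leibniz rule a product of functions
    annihilated in [j.+1] and [k.+1] steps is annihilated in [(j + k).+1]
    steps ([annihilatedM]): a term of the iterated derivative survives only if
    the first factor is hit at most [j] times and the second at most [k]
    times.  A monomial with [n] occurrences of [x] is therefore annihilated in
    [n.+1] steps.

    The product rule needs the linear part to be [O(|a|)], which
    differentiability in the Gateaux sense does not give directly.  The
    induction therefore uses a first-order expansion with a linear part in
    [O(|a|)] and a remainder in [O(|a|^2)] ([tangent]); it is stable under sums
    and products and implies differentiability in the Gateaux sense
    ([tangent_is_gateaux]). *)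

Section Annihilation.
Local Open Scope classical_set_scope.
Context {R : realType} {D : completeDivRingType R}.
Implicit Types (f g L M : D -> D) (x h : D).

(** * The absolute value and the topology *)

Lemma dabs0 : dabs (0 : D) = 0.
Proof. exact/dabs_eq0. Qed.

Lemma dabsN (x : D) : dabs (- x) = dabs x.
Proof.
by have := metric_sym 0 x; rewrite !mdist_dabs sub0r subr0.
Qed.

Lemma dabs_gt0 (x : D) : x != 0 -> 0 < dabs x.
Proof.
move=> x0; rewrite lt_neqAle dabs_ge0 andbT eq_sym.
by apply: contra_neq x0 => /dabs_eq0.
Qed.

Lemma ball_dabs (x y : D) (e : R) : ball x e y <-> dabs (y - x) < e.
Proof. by rewrite ballEmdist /= metric_sym mdist_dabs. Qed.

(** This is where the topology of the rationals enters: it makes the nonzero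
    rationals accumulate at 0 in [D], and rationals are central. *)
Lemma small_central (e : R) : 0 < e ->
  exists t : D, [/\ central t, t != 0 & dabs t < e].
Proof.
move=> e0; have [ratr_inj ratr_cont _] := @ratr_homeo R D.
have ratr0 : ratr 0 = 0 :> D by rewrite /ratr mul0r.
have : \forall q \near (0 : rat^o), ball (ratr 0 : D) e (ratr q).
  exact: (cvg_ball (ratr_cont 0)).
move=> /nbhs_ballP[d /= d0 dP].
have d20 : d / 2 != 0 by rewrite gt_eqF// divr_gt0.
exists (ratr (d / 2)); split.
- move=> y; apply/commr_sym; apply: commrM; first exact: commr_int.
  exact/commrV/commr_int.
- by rewrite -ratr0; apply: contra_neq d20 => /ratr_inj.
- have : ball (0 : rat^o) d (d / 2 : rat^o).
    rewrite /ball/= sub0r normrN gtr0_norm ?divr_gt0//.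
    by rewrite ltr_pdivrMr// ltr_pMr// ltr1n.
  by move=> /dP /ball_dabs; rewrite ratr0 subr0.
Qed.

(** * Uniqueness of the derivative *)

Lemma center_linear0 L : center_linear L -> L 0 = 0.
Proof. by case=> LD _; apply: (addrI (L 0)); rewrite -LD !addr0. Qed.

(** Numerator and denominator of [|L a| / |a|] scale alike along the small
    central multiples of [a], so the ratio equals its limit at 0. *)
Lemma center_linear_small_eq0 L : center_linear L ->
  (dabs (L a) / dabs a) @[a --> (0 : D)^'] --> (0 : R) -> forall a, L a = 0.
Proof.
move=> lL L0 a; apply: contrapT => /eqP La0.
have a0 : a != 0.
  by apply: contraNneq La0 => ->; rewrite (center_linear0 lL).
(* The ratio at [a] itself serves as radius: the ratio at [t a], which has the
   same value, cannot be closer to 0 than that. *)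
have r0 : 0 < dabs (L a) / dabs a by rewrite divr_gt0 ?dabs_gt0.
have : \forall b \near (0 : D)^',
    ball (0 : R) (dabs (L a) / dabs a) (dabs (L b) / dabs b).
  exact: (cvg_ball L0).
move=> /nbhs_ballP[d /= d0 dP].
have [|t [tC t0 td]] := @small_central (d / dabs a).
  by rewrite divr_gt0// dabs_gt0.
have ta0 : t * a != 0.
  by apply/eqP => /dabs_eq0/eqP; rewrite dabsM mulf_eq0 !gt_eqF ?dabs_gt0.
have : ball 0 d (t * a).
  by apply/ball_dabs; rewrite subr0 dabsM -ltr_pdivlMr// dabs_gt0.
move=> /dP /(_ ta0); rewrite /ball/= sub0r normrN lL.2// !dabsM.
rewrite -mulf_div divff ?mul1r ?gtr0_norm ?ltxx//.
by rewrite gt_eqF// dabs_gt0.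
Qed.

Lemma is_gateaux_unique f x L M :
  is_gateaux f x L -> is_gateaux f x M -> L = M.
Proof.
move=> [lL [o [fL _ oL]]] [lM [p [fM _ pM]]].
apply/funext => a; apply/eqP; rewrite -subr_eq0; apply/eqP; move: a.
have lLM : center_linear (fun a => L a - M a).
  split=> [a b|c a cC]; first by rewrite lL.1 lM.1 opprD addrACA.
  by rewrite lL.2// lM.2// mulrBr.
apply: (center_linear_small_eq0 lLM).
(* [L a + o a = M a + p a], hence the difference is a difference of
   remainders. *)
have LMop a : L a - M a = p a - o a.
  by apply/eqP; rewrite subr_eq addrAC eq_sym subr_eq addrC -fM fL.
apply/cvg_ballP => e e0; have e20 : 0 < e / 2 by rewrite divr_gt0.
near=> a.
have : ball (0 : R) (e / 2) (dabs (o a) / dabs a).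
  by near: a; exact: (cvg_ball oL).
have : ball (0 : R) (e / 2) (dabs (p a) / dabs a).
  by near: a; exact: (cvg_ball pM).
rewrite /ball/= !sub0r !normrN !ger0_norm ?divr_ge0 ?dabs_ge0// => pe oe.
apply: le_lt_trans (_ : (dabs (p a) + dabs (o a)) / dabs a < e).
  rewrite ler_wpM2r ?invr_ge0 ?dabs_ge0// LMop -(dabsN (o a)).
  exact: dabsD.
by rewrite mulrDl [e]splitr ltrD.
Unshelve. all: by end_near.
Qed.

Lemma gateauxP f x L : is_gateaux f x L -> gateaux f x = L.
Proof. by move=> fL; apply: xget_unique => // M /is_gateaux_unique; apply. Qed.

(** * Expansions with quadratic remainder *)

(** The bound is only asked on the unit ball, so that powers of [|a|] can be
    absorbed in the constant. *)
Definition tangent f x L : Prop :=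
  center_linear L /\
  exists2 C : R, 0 <= C & forall a, dabs a <= 1 ->
    dabs (L a) <= C * dabs a /\
    dabs (f (x + a) - f x - L a) <= C * dabs a ^+ 2.

(** A tangent function varies by [O(|a|)]; the constant is shared between the
    three bounds for use in the product rule. *)
Lemma tangent_bounds f x L : tangent f x L ->
  exists2 C : R, 0 <= C & forall a, dabs a <= 1 ->
    [/\ dabs (L a) <= C * dabs a,
        dabs (f (x + a) - f x - L a) <= C * dabs a ^+ 2
      & dabs (f (x + a) - f x) <= C * dabs a].
Proof.
move=> [_ [C C0 CP]]; exists (C + C) => [|a a1]; first exact: addr_ge0.
have [La fLa] := CP _ a1; have a0 := dabs_ge0 a.
have Ca0 : 0 <= C * dabs a by rewrite mulr_ge0.
have Ca20 : 0 <= C * dabs a ^+ 2 by rewrite mulr_ge0// exprn_ge0.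
have Ca2 : C * dabs a ^+ 2 <= C * dabs a by rewrite ler_wpM2l// expr2 ler_piMr.
split; first by rewrite mulrDl (le_trans La)// lerDl.
  by rewrite mulrDl (le_trans fLa)// lerDl.
rewrite -[_ - _](subrK (L a)) (le_trans (dabsD _ _))// mulrDl lerD//.
exact: le_trans Ca2.
Qed.

Lemma Lipschitz_continuous g x (C : R) : 0 <= C ->
  (forall a, dabs a <= 1 -> dabs (g (x + a) - g x) <= C * dabs a) ->
  {for x, continuous g}.
Proof.
move=> C0 gC; apply/cvg_ballP => e e0.
have C1 : 0 < C + 1 by rewrite ltr_wpDl.
near=> y; apply/ball_dabs.
have y1 : dabs (y - x) < 1.
  by apply/ball_dabs; near: y; apply: nbhsx_ballx.
have ye : dabs (y - x) < e / (C + 1).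
  by apply/ball_dabs; near: y; apply: nbhsx_ballx; rewrite divr_gt0.
have := gC _ (ltW y1); rewrite subrKC => /le_lt_trans; apply.
apply: le_lt_trans (_ : (C + 1) * dabs (y - x) < e).
  by rewrite ler_wpM2r ?dabs_ge0// lerDl.
by rewrite mulrC -ltr_pdivlMr.
Unshelve. all: by end_near.
Qed.

(** Continuity of the remainder is a condition at every increment, not only
    at 0, so the expansion of [f] is needed at every point. *)
Lemma tangent_is_gateaux f (df : D -> D -> D) :
  (forall x, tangent f x (df x)) -> forall x, is_gateaux f x (df x).
Proof.
move=> fdf x; have [lL _] := fdf x; split => //.
have [C C0 CP] := tangent_bounds (fdf x).
exists (fun a => f (x + a) - f x - df x a); split.
- by move=> a; rewrite subrKC.
- move=> a; have [E E0 EP] := tangent_bounds (fdf (x + a)).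
  apply: (@Lipschitz_continuous _ _ (E + C)) => [|b b1]; first exact: addr_ge0.
  have -> : f (x + (a + b)) - f x - df x (a + b) - (f (x + a) - f x - df x a)
          = (f (x + a + b) - f (x + a)) + - df x b.
    rewrite lL.1 opprD !addrA [LHS]addrAC; congr (_ - _).
    rewrite -(addrA (f (x + a + b))) -(addrA (f (x + a))).
    by rewrite [f (x + a) + _]addrC addrKA.
  have [_ _ fb] := EP _ b1; have [Lb _ _] := CP _ b1.
  by rewrite (le_trans (dabsD _ _))// dabsN mulrDl lerD.
- apply/cvg_ballP => e e0; have C1 : 0 < C + 1 by rewrite ltr_wpDl.
  near=> a.
  have a0 : 0 < dabs a.
    by apply: dabs_gt0; near: a; exact: nbhs_dnbhs_neq.
  have a1 : dabs a < 1.
    rewrite -(subr0 a); apply/ball_dabs; near: a.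
    by apply: nbhs_dnbhs; apply: nbhsx_ballx.
  have ae : dabs a < e / (C + 1).
    rewrite -[a in dabs a](subr0 a); apply/ball_dabs; near: a.
    by apply: nbhs_dnbhs; apply: nbhsx_ballx; rewrite divr_gt0.
  have [_ fa _] := CP _ (ltW a1).
  rewrite /ball/= sub0r normrN ger0_norm ?divr_ge0 ?dabs_ge0//.
  rewrite ltr_pdivrMr// (le_lt_trans fa)// expr2 mulrA ltr_pM2r//.
  apply: le_lt_trans (_ : (C + 1) * dabs a < e).
    by rewrite ler_wpM2r ?dabs_ge0// lerDl.
  by rewrite mulrC -ltr_pdivlMr.
Unshelve. all: by end_near.
Qed.

Lemma tangent_cst (c : D) x : tangent (fun=> c) x (fun=> 0).
Proof.
split; first by split=> [a b|b a _]; rewrite ?addr0 ?mulr0.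
by exists 0 => // a _; rewrite subrr subr0 dabs0 !mul0r.
Qed.

Lemma tangent_id x : tangent id x id.
Proof.
split=> //; exists 1 => // a _.
by rewrite mul1r [x + a]addrC addrK subrr dabs0 mul1r exprn_ge0 ?dabs_ge0.
Qed.

Lemma tangentD f g x L M : tangent f x L -> tangent g x M ->
  tangent (fun y => f y + g y) x (fun a => L a + M a).
Proof.
move=> [lL [C C0 CP]] [lM [E E0 EP]]; split.
  split=> [a b|c a cC]; first by rewrite lL.1 lM.1 addrACA.
  by rewrite lL.2// lM.2// mulrDr.
exists (C + E) => [|a a1]; first exact: addr_ge0.
have [La fa] := CP _ a1; have [Ma ga] := EP _ a1.
split; first by rewrite mulrDl (le_trans (dabsD _ _))// lerD.
have -> : f (x + a) + g (x + a) - (f x + g x) - (L a + M a) =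
  (f (x + a) - f x - L a) + (g (x + a) - g x - M a).
  by rewrite !opprD [RHS]addrACA; congr (_ + _); rewrite addrACA.
by rewrite mulrDl (le_trans (dabsD _ _))// lerD.
Qed.

(** The product rule, with the order of the factors kept. *)
Lemma tangentM f g x L M : tangent f x L -> tangent g x M ->
  tangent (fun y => f y * g y) x (fun a => L a * g x + f x * M a).
Proof.
move=> fL gM; have [lL _] := fL; have [lM _] := gM.
have [C C0 CP] := tangent_bounds fL; have [E E0 EP] := tangent_bounds gM.
split.
  split=> [a b|c a cC].
    by rewrite lL.1 lM.1 mulrDl mulrDr addrACA.
  by rewrite lL.2// lM.2// mulrDr !mulrA (cC (f x)).
have A0 := dabs_ge0 (f x); have B0 := dabs_ge0 (g x).
set A := dabs (f x) in A0 *; set B := dabs (g x) in B0 *.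
exists ((C * (E + B) + A * E) + C * E) => [|a a1].
  by rewrite !addr_ge0 ?mulr_ge0 ?addr_ge0.
have [La fa _] := CP _ a1; have [Ma ga ga'] := EP _ a1.
have a0 := dabs_ge0 a.
split.
  rewrite (le_trans (dabsD _ _))// !dabsM -/A -/B.
  apply: le_trans (_ : C * dabs a * B + A * (E * dabs a) <= _).
    by rewrite lerD ?ler_wpM2r ?ler_wpM2l.
  rewrite mulrAC mulrA -mulrDl ler_wpM2r// -[leLHS]addr0 lerD ?mulr_ge0//.
  by rewrite lerD2r ler_wpM2l// lerDr.
have -> : f (x + a) * g (x + a) - f x * g x - (L a * g x + f x * M a) =
  (f (x + a) - f x - L a) * g (x + a) + f x * (g (x + a) - g x - M a)
   + L a * (g (x + a) - g x).
  rewrite !mulrBl !mulrBr.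
  rewrite [X in _ = X + _ + _]addrAC -(addrA (f x * g (x + a))).
  rewrite opprD subrKA [RHS]addrAC subrKA !addrA.
  by congr (_ - _); rewrite addrAC.
have gxa : dabs (g (x + a)) <= E + B.
  rewrite -(subrK (g x) (g (x + a))) (le_trans (dabsD _ _))// lerD2r.
  by rewrite (le_trans ga')// ler_piMr.
rewrite [leRHS]mulrDl (mulrDl (C * (E + B))).
rewrite (le_trans (dabsD _ _))// lerD//.
  rewrite (le_trans (dabsD _ _))// !dabsM lerD//.
    by rewrite mulrAC ler_pM ?dabs_ge0.
  by rewrite -mulrA ler_wpM2l.
by rewrite dabsM expr2 mulrACA ler_pM ?dabs_ge0.
Qed.

(** * Functions annihilated by iterated differentiation *)

Fixpoint annihilated k f : Prop :=
  if k is k'.+1 then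
    exists2 df : D -> D -> D, forall x, tangent f x (df x)
      & forall h, annihilated k' (df ^~ h)
  else forall x, f x = 0.

Lemma annihilated0 k f : (forall x, f x = 0) -> annihilated k f.
Proof.
elim: k f => // k IHk f f0; exists (fun _ _ => 0) => [x|h]; last exact: IHk.
by rewrite (funext f0); exact: tangent_cst.
Qed.

Lemma annihilated_cst (c : D) : annihilated 1 (fun=> c).
Proof. by exists (fun _ _ => 0) => // x; exact: tangent_cst. Qed.

Lemma annihilated_id : annihilated 2 id.
Proof.
by exists (fun _ h => h) => [x|h]; [exact: tangent_id|exact: annihilated_cst].
Qed.

Lemma annihilatedD k f g : annihilated k f -> annihilated k g ->
  annihilated k (fun x => f x + g x).
Proof.
elim: k f g => [f g f0 g0 x|k IHk f g [df fdf dfk] [dg gdg dgk]].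
  by rewrite f0 g0 addr0.
exists (fun x h => df x h + dg x h) => [x|h]; first exact: tangentD.
exact: IHk (dfk h) (dgk h).
Qed.

(** Each derivative of the product lowers by one the count of one factor.  A
    count is one more than the number of derivatives that may survive; these
    numbers add up, hence the predecessor. *)
Lemma annihilatedM j k f g : annihilated j f -> annihilated k g ->
  annihilated (j + k).-1 (fun x => f x * g x).
Proof.
elim: j k f g => [|j IHj] k f g.
  by move=> f0 _; apply: annihilated0 => x; rewrite f0 mul0r.
move=> fj; elim: k g => [|k IHk] g.
  by move=> g0; apply: annihilated0 => x; rewrite g0 mulr0.
move=> gk; have [df fdf dfj] := fj; have [dg gdg dgk] := gk.
rewrite addSn addnS /=.
exists (fun x h => df x h * g x + f x * dg x h) => [x|h].
  exact: tangentM.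
apply: annihilatedD; last exact: IHk (dgk h).
by have := IHj k.+1 _ _ (dfj h) gk; rewrite addnS.
Qed.

Lemma annihilated_prod n (b : 'I_n -> D) :
  annihilated n.+1 (fun x => \prod_(i < n) (x * b i)).
Proof.
elim: n b => [b|n IHn b].
  rewrite (_ : (fun x => _) = fun=> 1); first exact: annihilated_cst.
  by apply/funext => x; rewrite big_ord0.
rewrite (_ : (fun x => _) =
    fun x => x * b ord0 * \prod_(i < n) (x * b (lift ord0 i))); last first.
  by apply/funext => x; rewrite big_ord_recl.
apply: (@annihilatedM 2 n.+1); last exact: IHn.
exact: annihilatedM annihilated_id (annihilated_cst _).
Qed.

Lemma annihilated_monomial n (a : 'I_n.+1 -> D) :
  annihilated n.+1 (monomial a).
Proof. exact: annihilatedM (annihilated_cst _) (annihilated_prod _). Qed.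

Lemma annihilated_gateaux_differentiable k f :
  annihilated k.+1 f -> gateaux_differentiable f.
Proof. by move=> [df fdf _] x; exists (df x); exact: tangent_is_gateaux. Qed.

(** Uniqueness of the derivative turns the derivatives witnessing
    [annihilated] into those selected by [gateaux]. *)
Lemma annihilated_ngateaux k (h : seq D) f :
  annihilated (size h + k) f -> annihilated k (ngateaux f h).
Proof.
elim: h f => [|h s IHs] f //= [df fdf dfk]; apply: IHs.
rewrite (_ : (fun x => _) = df ^~ h); first exact: dfk.
by apply/funext => x; rewrite (gateauxP (tangent_is_gateaux fdf x)).
Qed.

End Annihilation.

Theorem theorem9p3 (R : realType) (D : completeDivRingType R)
    (n : nat) (a : 'I_n.+1 -> D) :
  (forall (k : nat) (h : k.-tuple D), (k <= n)%N ->
     gateaux_differentiable (ngateaux (monomial a) h)) /\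
  (forall (x : D) (h : n.+1.-tuple D), ngateaux (monomial a) h x = 0).
Proof.
split=> [k h kn|x h].
  apply: (@annihilated_gateaux_differentiable _ _ (n - k)).
  apply: annihilated_ngateaux; rewrite size_tuple addnS subnKC//.
  exact: annihilated_monomial.
have: annihilated 0 (ngateaux (monomial a) h).
  by apply: annihilated_ngateaux; rewrite size_tuple addn0;
    exact: annihilated_monomial.
exact.
Qed.
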